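(* Define operators on the space $\mathbb C[x,y]$ of polynomials in two variables by $$\mathfrak b^{(0)}f(x,y)=\frac{f(x,y)-f(y,x)}{x-y},\qquad \mathfrak bf(x,y)=\frac{x\,\bigl(f(x,y)-f(y,x)\bigr)}{x-y},$$ $$r^{(s)}:\ x^iy^j\mapsto\theta(i-j)\,x^iy^j-\theta(j-i)\,x^jy^i .$$ 1. The Bézout operator $\mathfrak b^{(0)}$ satisfies the associative classical Yang--Baxter equation $\mathfrak b^{(0)}\circ\mathfrak b^{(0)}=0$. 2. The Bézout operator $\mathfrak b$ and the operator $r^{(s)}$ satisfy the non-homogeneous associative classical Yang--Baxter equation $r\circ r=c\,r_{13}$ with $c=1$.
   Context: $\theta(m)=1$ for $m>0$ and $\theta(m)=0$ for $m\le0$. Let $\mathcal F$ be the space of polynomials in one variable; $\mathbb C[x,y]=\mathcal F\otimes\mathcal F$ and $\mathbb C[x,y,z]=\mathcal F\otimes\mathcal F\otimes\mathcal F$. For an operator $r$ on $\mathcal F\otimes\mathcal F$, $r_{ab}$ denotes $r$ acting in the tensor factors number $a$ and $b$ of $\mathcal F^{\otimes3}$, and $r\circ r:=r_{12}r_{13}+r_{13}r_{23}-r_{23}r_{12}$ (composition of operators on $\mathcal F^{\otimes 3}$). *)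

(* Defs.v *)
From HB Require Import structures.
From mathcomp Require Import all_boot all_order all_algebra.
From mathcomp Require Import ssrcomplements.
From mathcomp Require Export mpoly.

Set Implicit Arguments.
Unset Strict Implicit.
Unset Printing Implicit Defensive.

Import GRing.Theory.
Local Open Scope ring_scope.

(* The n-fold tensor power of the space of one-variable polynomials is
   {mpoly K[n]}, a pure tensor of monomials being a monomial 'X_[m].  Tensor
   factors are numbered from 0, so that x = 'X_0, y = 'X_1, z = 'X_2. *)
Notation operator K n := {linear {mpoly K[n]} -> {mpoly K[n]}}.

Section LinearExtension.
Variables (K : fieldType) (n : nat) (V : lmodType K) (F : 'X_{1..n} -> V).

Definition linext (p : {mpoly K[n]}) : V := \sum_(m <- msupp p) p@_m *: F m.

Lemma linext_wide (d : nat) (p : {mpoly K[n]}) : (msize p <= d)%N ->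
  linext p = \sum_(m : 'X_{1..n < d}) p@_m *: F m.
Proof.
move=> le_pd; rewrite /linext (big_mksub 'X_{1..n < d}) /=; first last.
- by move=> m /msize_mdeg_lt /leq_trans; apply.
- exact: msupp_uniq.
by rewrite big_rmcond //= => m /memN_msupp_eq0 ->; rewrite scale0r.
Qed.

Lemma linext_is_linear : linear linext.
Proof.
move=> c p q; pose d := maxn (msize (c *: p + q)) (maxn (msize p) (msize q)).
rewrite !(@linext_wide d) /d; last 3 first.
- by rewrite !leq_max leqnn ?orbT.
- by rewrite !leq_max leqnn ?orbT.
- by rewrite !leq_max leqnn ?orbT.
rewrite scaler_sumr -big_split /=; apply: eq_bigr => m _.
by rewrite mcoeffD mcoeffZ scalerDl scalerA.
Qed.

HB.instance Definition _ :=
  GRing.isLinear.Build K {mpoly K[n]} V _ linext linext_is_linear.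

Lemma linextX (m : 'X_{1..n}) : linext 'X_[m] = F m.
Proof. by rewrite /linext msuppX big_seq1 mcoeffX eqxx scale1r. Qed.

End LinearExtension.

Section YangBaxter.
Variable K : fieldType.

(* r_{ab}, for distinct a and b: the first factor of r acts in factor a, the
   second one in factor b. *)
Definition leg (r : operator K 2) (a b : 'I_3) : operator K 3 :=
  linext (fun m : 'X_{1..3} =>
    (r ('X_0 ^+ m a * 'X_1 ^+ m b) \mPo [tuple 'X_a; 'X_b])
    * \prod_(c < 3 | (c != a) && (c != b)) 'X_c ^+ m c).

Definition aybe_op (r : operator K 2) : {mpoly K[3]} -> {mpoly K[3]} :=
  let r12 := leg r 0 1 in let r13 := leg r 0 2 in let r23 := leg r 1 2 in
  (r12 \o r13) \+ (r13 \o r23) \- (r23 \o r12).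

Definition aybe (r : operator K 2) : Prop := aybe_op r =1 (fun=> 0).

Definition aybe_nonhom (c : K) (r : operator K 2) : Prop :=
  aybe_op r =1 (fun f => c *: leg r 0 2 f).

End YangBaxter.

Section Operators.
Variable K : fieldType.
Implicit Types f g p : {mpoly K[2]}.

Definition flip f : {mpoly K[2]} := f \mPo [tuple 'X_1; 'X_0].

Definition divisible p : Prop := exists g, g * ('X_0 - 'X_1) == p.

(* The exact quotient p / (x - y) in K[x, y], unique by quotXY_unique. *)
Definition quotXY p (dvd_p : divisible p) : {mpoly K[2]} := xchoose dvd_p.

Lemma quotXYK p (dvd_p : divisible p) : quotXY dvd_p * ('X_0 - 'X_1) = p.
Proof. exact/eqP/(xchooseP dvd_p). Qed.

Lemma subXY_neq0 : 'X_0 - 'X_1 != 0 :> {mpoly K[2]}.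
Proof.
apply/eqP => /(congr1 (fun p => p.@[fun i => (i == 0)%:R])) /eqP.
by rewrite mevalB !mevalXU meval0 eqxx subr0 oner_eq0.
Qed.

Lemma quotXY_unique p (dvd_p : divisible p) g :
  g * ('X_0 - 'X_1) = p -> g = quotXY dvd_p.
Proof. by move=> gE; apply: (mulIf subXY_neq0); rewrite quotXYK. Qed.

Lemma divisible_sub_flip f : divisible (f - flip f).
Proof.
elim/mpolyind: f => [|c m p _ _ [g /eqP gE]].
  by exists 0; rewrite mul0r /flip raddf0 subr0.
suff [h hE] : exists h, h * ('X_0 - 'X_1) = 'X_[m] - flip 'X_[m].
  exists (c *: h + g); rewrite mulrDl gE -scalerAl hE /flip.
  by rewrite linearP /= scalerBr opprD addrACA.
have XE : 'X_[m] = 'X_0 ^+ m 0 * 'X_1 ^+ m 1 :> {mpoly K[2]}.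
  rewrite mpolyXE_id !big_ord_recl big_ord0 mulr1.
  by congr ('X_ _ ^+ m _ * 'X_ _ ^+ m _); apply/val_inj.
have flipE : flip 'X_[m] = 'X_1 ^+ m 0 * 'X_0 ^+ m 1.
  by rewrite XE /flip rmorphM !rmorphXn /= !comp_mpolyXU.
rewrite flipE XE; move: (m 0) (m 1) => i j.
set x : {mpoly K[2]} := 'X_0; set y : {mpoly K[2]} := 'X_1.
wlog le_ij : i j / (j <= i)%N => [W|].
  have [/W//|/ltnW /W[h hE]] := leqP j i.
  exists (- h); rewrite mulNr hE opprB.
  by rewrite [x ^+ i * _]mulrC [y ^+ i * _]mulrC.
rewrite -(subnK le_ij); move: (i - j)%N => k.
exists ((\sum_(t < k) x ^+ (k.-1 - t) * y ^+ t) * (x ^+ j * y ^+ j)).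
rewrite mulrAC [_ * (x - y)]mulrC -subrXX mulrBl !exprD.
by congr (_ - _); rewrite mulrA // mulrAC.
Qed.

Lemma divisible_mulX f : divisible ('X_0 * (f - flip f)).
Proof.
by have [g /eqP gE] := divisible_sub_flip f; exists ('X_0 * g); rewrite -mulrA gE.
Qed.

Definition bezout0 f : {mpoly K[2]} := quotXY (divisible_sub_flip f).

Definition bezout f : {mpoly K[2]} := quotXY (divisible_mulX f).

Lemma bezout0_is_linear : linear bezout0.
Proof.
move=> c f g; apply/esym/quotXY_unique.
rewrite mulrDl -scalerAl !quotXYK /flip linearP /=.
by rewrite scalerBr opprD addrACA.
Qed.

HB.instance Definition _ := GRing.isLinear.Build K {mpoly K[2]} {mpoly K[2]} _
  bezout0 bezout0_is_linear.

Lemma bezout_is_linear : linear bezout.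
Proof.
move=> c f g; apply/esym/quotXY_unique.
rewrite mulrDl -scalerAl !quotXYK /flip linearP /= scalerAr -mulrDr.
by rewrite scalerBr opprD addrACA.
Qed.

HB.instance Definition _ := GRing.isLinear.Build K {mpoly K[2]} {mpoly K[2]} _
  bezout bezout_is_linear.

Definition theta (m : int) : K := (0 < m)%R%:R.

Definition rs : {mpoly K[2]} -> {mpoly K[2]} :=
  linext (fun m : 'X_{1..2} =>
    let i := m 0 in let j := m 1 in
    theta (i%:Z - j%:Z) *: ('X_0 ^+ i * 'X_1 ^+ j)
    - theta (j%:Z - i%:Z) *: ('X_0 ^+ j * 'X_1 ^+ i)).

HB.instance Definition _ := GRing.Linear.on rs.

End Operators.

(* Main.v *)
Require Import Defs.
From mathcomp Require Import all_boot all_order all_algebra reals complex.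
From mathcomp Require Import perm ring zify.

Set Implicit Arguments.
Unset Strict Implicit.
Unset Printing Implicit Defensive.

Import GRing.Theory.
Local Open Scope ring_scope.

(** Write [s_ab] for the exchange of the variables number [a] and [b].

    Both Bezout operators have the form [r = phi (1 - s)], where [s] exchanges
    [x] and [y] and [phi = w(x, y) / (x - y)], with [w = 1] for [bezout0] and
    [w = x] for [bezout].  Hence [r_ab = phi_ab (1 - s_ab)] with
    [phi_ab = w(x_a, x_b) / (x_a - x_b)] ([leg_divided_swap]).  Moving all
    exchanges to the right of the rational functions and using
    [s_12 s_13 = s_13 s_23 = s_23 s_12] ([swap_swap]),

<<
    r_12 r_13 + r_13 r_23 - r_23 r_12
      =   (phi_12 phi_13 + phi_13 phi_23 - phi_23 phi_12) 1
        - phi_13 (phi_12 + phi_21) s_13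
        + (phi_12 phi_23 + phi_13 phi_21 - phi_23 phi_13) s_12 s_13,
>>

    the coefficients of [s_12] and [s_23] cancelling.  This is [c r_13] as soon
    as [phi_12 + phi_21 = c] and
    [phi_12 phi_13 + phi_13 phi_23 - phi_23 phi_12 = c phi_13], since then the
    coefficient of [s_12 s_13] vanishes too.  Both conditions are immediate for
    [w = 1, c = 0] and for [w = x, c = 1] ([aybe_divided_swap]).  To stay within
    polynomials, everything is multiplied by [(x - y)(x - z)(y - z)], which is
    cancelled at the end ([divided_swaps_cybe]).

    The operator [r^(s)] sends a monomial to plus itself, to minus its exchange
    or to zero, according to the order of its two exponents, and so do its legs
    in three variables ([leg_rs_mon3]).  The equation on [x^i y^j z^k] then only
    depends on the relative order of [i], [j], [k] and is verified in each of
    the thirteen cases. *)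

(** * Exchanging variables *)

Section Swaps.
Variable K : fieldType.
Implicit Types (a b c : 'I_3) (f : {mpoly K[3]}) (p : {mpoly K[2]}).

Definition place a b p : {mpoly K[3]} := p \mPo [tuple 'X_a; 'X_b].

Definition swap a b f : {mpoly K[3]} := msym (tperm a b) f.

Lemma msymXU n (s : 'S_n) i : msym s ('X_i : {mpoly K[n]}) = 'X_(s i).
Proof. by rewrite /msym mmapX mmap1U. Qed.

Lemma msym_place (s : 'S_3) a b p :
  msym s (place a b p) = place (s a) (s b) p.
Proof.
rewrite /place; elim/mpolyind: p => [|c m p _ _ IH]; first by rewrite !raddf0.
rewrite !linearP /= IH; congr (c *: _ + _).
rewrite [in LHS](mpolyXE_id _ m) [in RHS](mpolyXE_id _ m) !rmorph_prod /=.
apply: eq_bigr => i _; rewrite !rmorphXn /= !comp_mpolyXU; congr (_ ^+ _).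
by case: i => [[|[|]]] //= _; rewrite msymXU.
Qed.

Lemma place_mon a b i j :
  place a b ('X_0 ^+ i * 'X_1 ^+ j) = 'X_a ^+ i * 'X_b ^+ j.
Proof. by rewrite /place rmorphM !rmorphXn /= !comp_mpolyXU. Qed.

Lemma flip_mon i j :
  flip ('X_0 ^+ i * 'X_1 ^+ j : {mpoly K[2]}) = 'X_0 ^+ j * 'X_1 ^+ i.
Proof. by rewrite /flip rmorphM !rmorphXn /= !comp_mpolyXU /= mulrC. Qed.

Lemma mpolyX_split a b (m : 'X_{1..3}) : a != b ->
  'X_[m] = 'X_a ^+ m a * 'X_b ^+ m b
           * \prod_(c < 3 | (c != a) && (c != b)) 'X_c ^+ m c :> {mpoly K[3]}.
Proof.
move=> ab; rewrite (mpolyXE_id _ m) (bigD1 a) //= (bigD1 b) /= ?mulrA //.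
by rewrite eq_sym.
Qed.

Lemma swap_split a b (m : 'X_{1..3}) : a != b ->
  swap a b 'X_[m] = 'X_a ^+ m b * 'X_b ^+ m a
           * \prod_(c < 3 | (c != a) && (c != b)) 'X_c ^+ m c.
Proof.
move=> ab; rewrite /swap (mpolyX_split m ab) !rmorphM !rmorphXn rmorph_prod /=.
rewrite !msymXU tpermL tpermR; congr (_ * _); first exact: mulrC.
by apply: eq_bigr => c /andP[ca cb]; rewrite rmorphXn /= msymXU tpermD // eq_sym.
Qed.

(** All three products are the same 3-cycle. *)
Lemma swap_swap f :
  swap 0 1 (swap 0 2 f) = swap 0 2 (swap 1 2 f) /\
  swap 1 2 (swap 0 1 f) = swap 0 2 (swap 1 2 f).
Proof.
by split; rewrite /swap -!msymMm; congr (msym _ f);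
  apply/permP => -[[|[|[|]]]] // l; rewrite !permM !permE /=; apply/val_inj.
Qed.

End Swaps.

(** * Operators built from a divided swap *)

(** The operator [r] is [w / (x - y) * (1 - flip)], with the denominator
    cleared. *)
Definition divided_swap (K : fieldType) (r : operator K 2) (w : {mpoly K[2]}) :=
  forall g, r g * ('X_0 - 'X_1) = w * (g - flip g).

(** On a monomial, the factors outside positions [a] and [b] are untouched both
    by the leg and by the swap, so the two-variable formula is multiplied by
    them. *)
Lemma leg_divided_swap (K : fieldType) (r : operator K 2) (w : {mpoly K[2]})
    (a b : 'I_3) (f : {mpoly K[3]}) :
  divided_swap r w -> a != b ->
  leg r a b f * ('X_a - 'X_b) = place a b w * (f - swap a b f).
Proof.
move=> rE ab; elim/mpolyind: f => [|c m f _ _ IH].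
  by rewrite /leg /swap !raddf0 addr0 mul0r mulr0.
have -> : leg r a b (c *: 'X_[m] + f) = c *: leg r a b 'X_[m] + leg r a b f.
  exact: linearP.
have -> : swap a b (c *: 'X_[m] + f) = c *: swap a b 'X_[m] + swap a b f.
  exact: linearP.
rewrite opprD addrACA -scalerBr mulrDl IH [RHS]mulrDr; congr (_ + _).
rewrite -scalerAl -scalerAr; congr (_ *: _).
rewrite [leg _ _ _ _]linextX (swap_split K m ab) (mpolyX_split K m ab).
rewrite -mulrBl mulrA mulrAC; congr (_ * _).
have -> : 'X_a - 'X_b = place a b ('X_0 - 'X_1) :> {mpoly K[3]}.
  by rewrite /place rmorphB /= !comp_mpolyXU.
rewrite -rmorphM rE rmorphM rmorphB /= flip_mon.
by rewrite -!/(place _ _ _) !place_mon.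
Qed.

(** The computation with [phi_ab = w_ab / (x_a - x_b)] in denominator-free
    form.  In terms of operators applied to [f], the letters [A], [B], [C]
    stand for [r_13 f], [r_23 f], [r_12 f], and [A'], [B'], [C'] for their
    images under [s_12], [s_13], [s_23]; then [P], [Q], [S] are the three
    products of the equation, [fab] is [s_ab f], and [g] is the image of [f]
    under the 3-cycle. *)
Lemma divided_swaps_cybe (D : idomainType) (x y z c w12 w13 w23 w21 : D)
    (f f12 f13 f23 g A A' P B B' Q C C' S : D) :
  x - y != 0 -> x - z != 0 -> y - z != 0 ->
  w12 - w21 = c * (x - y) ->
  w12 * w13 * (y - z) + w13 * w23 * (x - y) - w23 * w12 * (x - z)
    = c * w13 * (x - y) * (y - z) ->
  A * (x - z) = w13 * (f - f13) -> A' * (y - z) = w23 * (f12 - g) ->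
  P * (x - y) = w12 * (A - A') ->
  B * (y - z) = w23 * (f - f23) -> B' * (y - x) = w21 * (f13 - g) ->
  Q * (x - z) = w13 * (B - B') ->
  C * (x - y) = w12 * (f - f12) -> C' * (x - z) = w13 * (f23 - g) ->
  S * (y - z) = w23 * (C - C') ->
  P + Q - S = c * A.
Proof.
move=> xy xz yz skew yb hA hA' hP hB hB' hQ hC hC' hS.
have V0 : (x - y) * (x - z) * (y - z) != 0 by rewrite !mulf_neq0.
have PE : P * ((x - y) * (x - z) * (y - z)) =
    w12 * (w13 * (f - f13) * (y - z) - w23 * (f12 - g) * (x - z)).
  by rewrite -hA -hA' !mulrA hP; ring.
have QE : Q * ((x - y) * (x - z) * (y - z)) =
    w13 * (w23 * (f - f23) * (x - y) + w21 * (f13 - g) * (y - z)).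
  rewrite -hB -hB'.
  transitivity (Q * (x - z) * ((x - y) * (y - z))); first by ring.
  by rewrite hQ; ring.
have SE : S * ((x - y) * (x - z) * (y - z)) =
    w23 * (w12 * (f - f12) * (x - z) - w13 * (f23 - g) * (x - y)).
  rewrite -hC -hC'.
  transitivity (S * (y - z) * ((x - y) * (x - z))); first by ring.
  by rewrite hS; ring.
have cAE : c * A * ((x - y) * (x - z) * (y - z)) =
    c * w13 * (x - y) * (y - z) * (f - f13).
  transitivity (c * (A * (x - z)) * ((x - y) * (y - z))); first by ring.
  by rewrite hA; ring.
apply: (mulIf V0); rewrite mulrBl mulrDl PE QE SE cAE -yb.
have -> : w21 = w12 - c * (x - y) by rewrite -skew; ring.
(* What remains is the equation on w multiplied by f13 - g. *)
apply: subr0_eq; rewrite -[RHS](mulr0 (f13 - g)).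
have <- : w12 * w13 * (y - z) + w13 * w23 * (x - y) - w23 * w12 * (x - z)
   - c * w13 * (x - y) * (y - z) = 0 by rewrite yb subrr.
ring.
Qed.

(** The two conditions on [w] say that [phi = w / (x - y)] satisfies
    [phi_12 + phi_21 = c] and
    [phi_12 phi_13 + phi_13 phi_23 - phi_23 phi_12 = c phi_13]: a solution in
    commuting functions yields one in operators. *)
Lemma aybe_divided_swap (K : fieldType) (c : K) (r : operator K 2)
    (w : {mpoly K[2]}) :
  divided_swap r w ->
  place 0 1 w - place 1 0 w = c *: ('X_0 - 'X_1) ->
  place 0 1 w * place 0 2 w * ('X_1 - 'X_2)
  + place 0 2 w * place 1 2 w * ('X_0 - 'X_1)
  - place 1 2 w * place 0 1 w * ('X_0 - 'X_2)
    = c *: (place 0 2 w * ('X_0 - 'X_1) * ('X_1 - 'X_2)) ->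
  aybe_nonhom c r.
Proof.
move=> rE skew yb f; rewrite /aybe_op /= -[RHS]mul_mpolyC.
have subX_neq0 (a b : 'I_3) : a != b -> 'X_a - 'X_b != 0 :> {mpoly K[3]}.
  move=> ab; apply/eqP => /(congr1 (fun p => p.@[fun i => (i == a)%:R])) /eqP.
  by rewrite mevalB !mevalXU meval0 eqxx [b == a]eq_sym (negPf ab) subr0 oner_eq0.
have swapE (a b d e d' e' : 'I_3) (p q : {mpoly K[3]}) :
    tperm a b d = d' -> tperm a b e = e' ->
    p * ('X_d - 'X_e) = place d e w * q ->
  swap a b p * ('X_d' - 'X_e') = place d' e' w * swap a b q.
  move=> <- <- /(congr1 (swap a b)).
  by rewrite /swap !msymM msymB !msymXU msym_place.
have swapB a b (p q : {mpoly K[3]}) : swap a b (p - q) = swap a b p - swap a b q.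
  exact: msymB.
have legE a b p : a != b -> _ := @leg_divided_swap K r w a b p rE.
have [cyc01 cyc12] := swap_swap f; pose g := swap 0 2 (swap 1 2 f).
have tpermE (a b d : 'I_3) :
  tperm a b d = if d == a then b else if d == b then a else d by rewrite permE.
apply: (@divided_swaps_cybe _ 'X_0 'X_1 'X_2 _
  (place 0 1 w) (place 0 2 w) (place 1 2 w) (place 1 0 w)
  f (swap 0 1 f) (swap 0 2 f) (swap 1 2 f) g
  _ (swap 0 1 (leg r 0 2 f)) _ (leg r 1 2 f) (swap 0 2 (leg r 1 2 f))
  _ (leg r 0 1 f) (swap 1 2 (leg r 0 1 f))); rewrite ?subX_neq0 ?legE //.
- by rewrite mul_mpolyC.
- by rewrite yb -mul_mpolyC !mulrA.
- by rewrite /g -cyc01 -swapB; apply: (swapE _ _ 0 2); rewrite ?tpermE ?legE.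
- by rewrite /g -swapB; apply: (swapE _ _ 1 2); rewrite ?tpermE ?legE.
- by rewrite /g -cyc12 -swapB; apply: (swapE _ _ 0 1); rewrite ?tpermE ?legE.
Qed.

Lemma aybe_bezout0 (K : fieldType) : aybe (@bezout0 K : operator K 2).
Proof.
suff E : aybe_nonhom 0 (@bezout0 K : operator K 2).
  by move=> f; rewrite E scale0r.
apply: (@aybe_divided_swap _ _ _ 1) => [g||].
- by rewrite mul1r quotXYK.
- by rewrite /place !comp_mpoly1 subrr scale0r.
- by rewrite /place !comp_mpoly1 scale0r; ring.
Qed.

Lemma aybe_bezout (K : fieldType) : aybe_nonhom 1 (@bezout K : operator K 2).
Proof.
have wE a b : place a b 'X_0 = 'X_a :> {mpoly K[3]}.
  by rewrite /place comp_mpolyXU.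
apply: (@aybe_divided_swap _ _ _ 'X_0) => [g||].
- exact: quotXYK.
- by rewrite !wE scale1r.
- by rewrite !wE scale1r; ring.
Qed.

(** * The operator on monomials *)

Section MonomialOperator.
Variable K : fieldType.

Lemma rs_mon i j :
  rs ('X_0 ^+ i * 'X_1 ^+ j : {mpoly K[2]}) =
  (j < i)%N%:R *: ('X_0 ^+ i * 'X_1 ^+ j)
  - (i < j)%N%:R *: ('X_0 ^+ j * 'X_1 ^+ i).
Proof.
pose n : 'X_{1..2} := [multinom (if k == 0 :> nat then i else j) | k < 2].
have nE : 'X_0 ^+ i * 'X_1 ^+ j = 'X_[n] :> {mpoly K[2]}.
  rewrite (mpolyXE_id _ n) !big_ord_recl big_ord0 mulr1 !mnmE /=.
  by congr ('X_ _ ^+ _ * 'X_ _ ^+ _); apply/val_inj.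
by rewrite {1}nE /rs linextX !mnmE /= /theta !Num.Theory.subr_gt0 !ltz_nat.
Qed.

Lemma leg_rs_mon (a b : 'I_3) (m : 'X_{1..3}) : a != b ->
  leg (@rs K : operator K 2) a b 'X_[m] =
  (m b < m a)%N%:R *: 'X_[m] - (m a < m b)%N%:R *: swap a b 'X_[m].
Proof.
move=> ab; rewrite [leg _ _ _ _]linextX (swap_split K m ab) (mpolyX_split K m ab) /=.
rewrite rs_mon comp_mpolyB !comp_mpolyZ -!/(place _ _ _) !place_mon.
by rewrite mulrBl -!scalerAl.
Qed.

Definition mon3 i j k : {mpoly K[3]} :=
  'X_[[multinom nth 0%N [:: i; j; k] l | l < 3]].

Lemma mon3_mnm (m : 'X_{1..3}) : 'X_[m] = mon3 (m 0) (m 1) (m 2).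
Proof.
congr 'X_[_]; apply/mnmP => -[[|[|[|]]]] // l; rewrite mnmE /=;
  by congr (m _); apply/val_inj.
Qed.

Lemma swap_mon3 i j k :
  (swap 0 1 (mon3 i j k) = mon3 j i k) *
  (swap 0 2 (mon3 i j k) = mon3 k j i) *
  (swap 1 2 (mon3 i j k) = mon3 i k j).
Proof.
by do 2?split; rewrite /swap msymX; congr 'X_[_];
  apply/mnmP => -[[|[|[|]]]] // l; rewrite !mnmE tpermV permE.
Qed.

Lemma leg_rs_mon3 i j k (rK := @rs K : operator K 2) :
  (leg rK 0 1 (mon3 i j k)
     = (j < i)%N%:R *: mon3 i j k - (i < j)%N%:R *: mon3 j i k) *
  (leg rK 0 2 (mon3 i j k)
     = (k < i)%N%:R *: mon3 i j k - (i < k)%N%:R *: mon3 k j i) *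
  (leg rK 1 2 (mon3 i j k)
     = (k < j)%N%:R *: mon3 i j k - (j < k)%N%:R *: mon3 i k j).
Proof. by do 2?split; rewrite leg_rs_mon // swap_mon3 !mnmE. Qed.

Lemma linear_mon3_ext (V : lmodType K) (g h : {linear {mpoly K[3]} -> V}) :
  (forall i j k, g (mon3 i j k) = h (mon3 i j k)) -> g =1 h.
Proof.
move=> gh; elim/mpolyind => [|c m f _ _ IH]; first by rewrite !raddf0.
by rewrite !linearP IH mon3_mnm /= gh.
Qed.

Lemma aybe_rs : aybe_nonhom 1 (@rs K : operator K 2).
Proof.
move=> f; rewrite scale1r; move: f; set rK : operator K 2 := @rs K.
pose L12 := leg rK 0 1 : operator K 3; pose L13 := leg rK 0 2 : operator K 3.
pose L23 := leg rK 1 2 : operator K 3.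
pose lhs : operator K 3 := (L12 \o L13) \+ (L13 \o L23) \- (L23 \o L12).
apply: (@linear_mon3_ext _ lhs L13) => i j k.
have legE := leg_rs_mon3; rewrite -/rK -/L12 -/L13 -/L23 in legE.
rewrite /lhs /= !legE !linearB !linearZ /= !legE.
(* Ties matter: rs kills the monomials with equal exponents, and
   the substitution identifies the exchanged monomials. *)
case: (ltngtP i j) => ij; case: (ltngtP i k) => ik; case: (ltngtP j k) => jk;
  try lia; subst; rewrite ?(scale0r, scale1r, ltnn); ring.
Qed.

End MonomialOperator.

Theorem proposition9 (R : realType) :
  aybe (@bezout0 R[i] : operator R[i] 2) /\
  (aybe_nonhom 1 (@bezout R[i] : operator R[i] 2) /\
   aybe_nonhom 1 (@rs R[i] : operator R[i] 2)).
Proof.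
by split; [|split]; [exact: aybe_bezout0|exact: aybe_bezout|exact: aybe_rs].
Qed.
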